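(* Let $N$ be the 3-dimensional Heisenberg group with its left-invariant metric $g$ as defined in the context, with coordinates $(X,t)\in\mathbb{R}^2\times\mathbb{R}$, and let $L>0$. Let $\Gamma_Z=\{\gamma L\mid \gamma\in\mathbb{Z}\}$ be the lattice in the center $\mathbb{R}$, and let $\Delta$ be the Laplace operator of $(N,g)$ acting on functions. Then $$\Delta=\Delta_X+\Bigl(1+\tfrac14|X|^2\Bigr)\partial_{t}^2+\partial_t\,D\bullet ,$$ where $\Delta_X$ is the Euclidean Laplacian on $\mathbb{R}^2$ and $D\bullet$ is the directional derivative with respect to the vector field $X\mapsto J(X)$ on $\mathbb{R}^2$. Consequently, for every integer $\gamma$ and every smooth function $\varphi:\mathbb{R}^2\to\mathbb{C}$, the function $\phi^{(\gamma)}(X,t)=\varphi(X)e^{2\pi \mathbf{i}\gamma t/L}$ (which descends to $\Gamma_Z\backslash N$) satisfies $$\Delta\phi^{(\gamma)}=(\square_{(\lambda)}\varphi)\,e^{2\pi\mathbf{i}\gamma t/L},\qquad \square_{(\lambda)}=\Delta_X+2\mathbf{i}D_\lambda\bullet-4\lambda^2\Bigl(1+\tfrac14|X|^2\Bigr),\qquad \lambda=\frac{\pi\gamma}{L},$$ where $D_\lambda\bullet=\lambda D\bullet$.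
   Context: $J$ is the natural complex structure on $\mathbb{R}^2$ (rotation by $90^\circ$). The Lie algebra $\mathfrak n=\mathbb{R}^2\oplus\mathbb{R}$, with its natural Euclidean inner product $\langle\,,\rangle$, has center $\mathbb{R}$ and bracket determined by $\langle [X,Y],Z\rangle=\langle tJ(X),Y\rangle$ for $X,Y\in\mathbb{R}^2$ and $Z=t e_t\in\mathbb{R}$, where $e_t$ is the unit basis vector of the center. The group $N$ is identified with $\mathfrak n$ through the exponential map, with multiplication $(X,Z)(X^*,Z^* )=(X+X^*,Z+Z^*+\frac12[X,X^*])$, and $g$ is the left-invariant Riemannian metric extending $\langle\,,\rangle$ from the tangent space at the identity. Laplacians are the analysts' (nonpositive) ones, $\mathbf{i}=\sqrt{-1}$, $|X|$ is the Euclidean norm. *)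

(* Defs.v *)
From HB Require Import structures.
From mathcomp Require Import all_boot all_order all_algebra.
From mathcomp Require Import complex.
From mathcomp Require Import all_classical all_reals all_analysis.

Set Implicit Arguments.
Unset Strict Implicit.
Unset Printing Implicit Defensive.

Import Order.TTheory GRing.Theory Num.Theory.
Import numFieldNormedType.Exports.

Local Open Scope ring_scope.

Section Calculus.
Variables (R : realType) (V : normedModType R).

(* For [V] finite dimensional, infinitely differentiable: every iterated directional derivative (the
   function itself included) is Frechet differentiable everywhere. *)
Definition smooth (f : V -> R) : Prop :=
  forall (s : seq V) (p : V),
    differentiable (foldr (fun v (h : V -> R) => 'D_v h) f s) p.

Definition csmooth (f : V -> R[i]) : Prop :=
  smooth (fun p => complex.Re (f p)) /\ smooth (fun p => complex.Im (f p)).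

(* The complex-linear extension of a real linear operator. *)
Definition complexify (A : (V -> R) -> V -> R) (f : V -> R[i]) (p : V) : R[i] :=
  Complex (A (fun q => complex.Re (f q)) p) (A (fun q => complex.Im (f q)) p).

(* The metric [g p] at [p] is a bilinear form on the tangent space [V];
   [e] is a basis of [V], giving global linear coordinates. *)
Definition gram n (e : 'I_n -> V) (g : V -> V -> V -> R) (p : V) : 'M[R]_n :=
  \matrix_(i, j) g p (e i) (e j).

(* Laplace-Beltrami operator div grad (the analysts' sign):
   |g|^(-1/2) d_i (|g|^(1/2) g^ij d_j f). *)
Definition laplace_beltrami n (e : 'I_n -> V) (g : V -> V -> V -> R)
    (f : V -> R) (p : V) : R :=
  (Num.sqrt (\det (gram e g p)))^-1 *
  \sum_(i < n) 'D_(e i) (fun q => Num.sqrt (\det (gram e g q)) *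
     \sum_(j < n) invmx (gram e g q) i j * 'D_(e j) f q) p.

End Calculus.

Notation plane R := 'rV[R]_2 (only parsing).

(* The Heisenberg algebra, and the group through the exponential map:
   pairs (X, t). *)
Notation heis R := ('rV[R]_2 * R)%type (only parsing).

Section Heisenberg.
Variable R : realType.

Definition cexp (z : R[i]) : R[i] :=
  (expR (complex.Re z))%:C%C *
  Complex (cos (complex.Im z)) (sin (complex.Im z)).

Local Notation plane := (plane R).
Local Notation heis := (heis R).

Definition dot (X Y : plane) : R := \sum_(i < 2) X 0 i * Y 0 i.

(* The library norm on row vectors is the sup norm. *)
Definition enorm (X : plane) : R := Num.sqrt (dot X X).

Definition J (X : plane) : plane :=
  \row_(i < 2) (if i == 0 then - X 0 1 else X 0 0).

Definition laplace_plane (f : plane -> R) (X : plane) : R :=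
  \sum_(i < 2) 'D_(delta_mx 0 i : plane) ('D_(delta_mx 0 i : plane) f) X.

Definition dbullet_real (f : plane -> R) (X : plane) : R := 'D_(J X) f X.

Definition LaplaceX (f : plane -> R[i]) : plane -> R[i] :=
  complexify laplace_plane f.

Definition Dbullet (f : plane -> R[i]) : plane -> R[i] :=
  complexify dbullet_real f.

Definition Dbullet_lambda (lambda : R) (f : plane -> R[i]) (X : plane) : R[i] :=
  lambda%:C%C * Dbullet f X.

Definition box (lambda : R) (phi : plane -> R[i]) (X : plane) : R[i] :=
  LaplaceX phi X + 2 * 'i%C * Dbullet_lambda lambda phi X
  - (4 * lambda ^+ 2 * (1 + enorm X ^+ 2 / 4))%:C%C * phi X.

Definition heis_basis (i : 'I_(2 + 1)) : heis :=
  match fintype.split i with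
  | inl j => (delta_mx 0 j, 0)
  | inr _ => (0, 1)
  end.

Definition heis_inner (u v : heis) : R := dot u.1 v.1 + u.2 * v.2.

(* The central component of [X, Y], for X, Y in the plane: the relation
   <[X, Y], t e_t> = <t J X, Y> at t = 1 (see [bracketE]). *)
Definition bracket (X Y : plane) : R := dot (J X) Y.

Lemma bracketE (X Y : plane) (t : R) :
  heis_inner (0, bracket X Y) (0, t) = dot (t *: J X) Y.
Proof.
rewrite /heis_inner /bracket /dot /= big1 ?add0r; last first.
  by move=> i _; rewrite mxE mul0r.
rewrite mulrC mulr_sumr; apply: eq_bigr => i _.
by rewrite mulrA; congr (_ * _); rewrite [RHS]mxE.
Qed.

Definition heis_mul (p q : heis) : heis :=
  (p.1 + q.1, p.2 + q.2 + bracket p.1 q.1 / 2).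

Definition heis_inv (p : heis) : heis := (- p.1, - p.2).

(* The left-invariant metric: pull tangent vectors at [p] back to the identity
   by the differential of left translation by the inverse of [p]. *)
Definition heis_metric (p u v : heis) : R :=
  heis_inner ('d (heis_mul (heis_inv p)) p u) ('d (heis_mul (heis_inv p)) p v).

Lemma bracketDr (X Y Y' : plane) :
  bracket X (Y + Y') = bracket X Y + bracket X Y'.
Proof.
rewrite -big_split; apply: eq_bigr => i _.
by rewrite [(Y + Y') 0 i]mxE mulrDr.
Qed.

Lemma bracketDl (X X' Y : plane) :
  bracket (X + X') Y = bracket X Y + bracket X' Y.
Proof.
rewrite /bracket /dot -big_split; apply: eq_bigr => i _ /=.
by rewrite -mulrDl; congr (_ * _); rewrite !mxE; case: ifP => _; rewrite ?opprD.
Qed.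

Lemma bracketZr k (X Y : plane) : bracket X (k *: Y) = k * bracket X Y.
Proof.
by rewrite /bracket /dot mulr_sumr; apply: eq_bigr => i _; rewrite [(k *: Y) 0 i]mxE mulrCA.
Qed.

Lemma bracketNl (X Y : plane) : bracket (- X) Y = - bracket X Y.
Proof.
rewrite /bracket /dot -sumrN; apply: eq_bigr => i _.
by rewrite -mulNr; congr (_ * _); rewrite !mxE; case: ifP.
Qed.

Lemma bracket0l (Y : plane) : bracket 0 Y = 0.
Proof.
by rewrite /bracket /dot big1// => i _; rewrite [J 0 0 i]mxE !mxE oppr0 if_same mul0r.
Qed.

Definition heis_lin (a q : heis) : heis := (q.1, q.2 + bracket a.1 q.1 / 2).

Lemma heis_lin_linear (a : heis) : linear (heis_lin a).
Proof.
move=> k [X t] [Y s]; rewrite /heis_lin /=; congr (_, _).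
by rewrite bracketDr bracketZr /= mulrDl -mulrA scalerDr addrACA.
Qed.
HB.instance Definition _ (a : heis) :=
  GRing.isLinear.Build R heis heis *:%R (heis_lin a) (heis_lin_linear a).

Lemma heis_lin_continuous (a : heis) : continuous (heis_lin a).
Proof.
have c1 : continuous (fst : heis -> plane) by move=> q; exact: cvg_fst.
have c2 : continuous (snd : heis -> R) by move=> q; exact: cvg_snd.
have cb : continuous (fun q : heis => bracket a.1 q.1 / 2).
  move=> q; apply: cvgM; last exact: cvg_cst.
  rewrite /bracket /dot; apply: cvg_big => [|i _]; first exact: add_continuous.
  apply: cvgM; first exact: cvg_cst.
  apply: (@continuous_comp _ _ _ (fst : heis -> plane) (fun Y : plane => Y 0 i)).
    exact: c1.
  exact: coord_continuous.
move=> q; rewrite /continuous_at.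
by refine (cvg_pair (G := nbhs q.1) (c1 q) (cvgD (c2 q) (cb q))).
Qed.

Lemma diff_heis_mul (a p u : heis) :
  'd (heis_mul a) p u = (u.1, u.2 + bracket a.1 u.1 / 2).
Proof.
have -> : heis_mul a = cst a + heis_lin a :> (heis -> heis).
  by apply/funext => q; rewrite /heis_mul /heis_lin; congr (_, _); rewrite /= addrA.
have hd : differentiable (heis_lin a) p.
  by apply: linear_differentiable; exact: heis_lin_continuous.
have cl : continuous (heis_lin a) by exact: heis_lin_continuous.
pose ev (h : heis -> heis) := h u.
have Ec : 'd (cst a : heis -> heis) p u = 0.
  exact: (congr1 ev (@diff_cst R heis heis a p)).
have El : 'd (heis_lin a) p u = heis_lin a u.
  exact: (congr1 ev (diff_lin p cl)).
have dc : differentiable (cst a : heis -> heis) p by [].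
have E := congr1 ev (diffD dc hd).
apply: (etrans E); apply: (etrans (congr2 +%R Ec El)).
exact: add0r.
Qed.

Lemma heis_metric0 (u v : heis) : heis_metric 0 u v = heis_inner u v.
Proof.
have E (w : heis) : 'd (heis_mul (heis_inv 0)) (0 : heis) w = w.
  rewrite diff_heis_mul.
  have e0 : (heis_inv 0).1 = 0 by exact: oppr0.
  by rewrite e0 bracket0l mul0r addr0 -surjective_pairing.
by rewrite /heis_metric !E.
Qed.

Lemma heis_metric_left_invariant (q p u v : heis) :
  heis_metric (heis_mul q p) ('d (heis_mul q) p u) ('d (heis_mul q) p v) =
  heis_metric p u v.
Proof.
have E (w : heis) :
    'd (heis_mul (heis_inv (heis_mul q p))) (heis_mul q p) ('d (heis_mul q) p w)
    = 'd (heis_mul (heis_inv p)) p w.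
  apply: (etrans (diff_heis_mul _ _ _)).
  apply: (etrans _ (esym (diff_heis_mul _ _ _))).
  congr (_, _); first exact: (congr1 fst (diff_heis_mul q p w)).
  rewrite (congr1 fst (diff_heis_mul q p w)) (congr1 snd (diff_heis_mul q p w)).
  rewrite [fst _]/= [snd _]/=.
  have -> : (heis_inv (heis_mul q p)).1 = - (q.1 + p.1) by [].
  have -> : (heis_inv p).1 = - p.1 by [].
  by rewrite !bracketNl bracketDl opprD mulrDl !mulNr addrA addrK.
exact: (congr2 (@heis_inner) (E u) (E v)).
Qed.

Definition Laplace (f : heis -> R[i]) : heis -> R[i] :=
  complexify (laplace_beltrami heis_basis heis_metric) f.

Definition dt (f : heis -> R[i]) : heis -> R[i] :=
  complexify (fun h : heis -> R => 'D_((0, 1) : heis) h) f.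

(* An operator on functions of X acting on functions of (X, t), t fixed. *)
Definition inX (A : (plane -> R[i]) -> plane -> R[i]) (f : heis -> R[i])
    (p : heis) : R[i] :=
  A (fun X => f (X, p.2)) p.1.

Definition GammaZ (L : R) : set heis :=
  [set z | exists k : int, z = (0, k%:~R * L)]%classic.

Definition character (L : R) (gamma : int) (t : R) : R[i] :=
  cexp ('i%C * (2 * pi * gamma%:~R * t / L)%:C%C).

Definition phi_gamma (L : R) (gamma : int) (phi : plane -> R[i]) (p : heis)
    : R[i] :=
  phi p.1 * character L gamma p.2.

End Heisenberg.

(* Main.v *)
Require Import Defs.
From mathcomp Require Import all_boot all_order all_algebra.
From mathcomp Require Import complex.
From mathcomp Require Import all_classical all_reals all_analysis.
From mathcomp Require Import ring lra.
Import Order.TTheory GRing.Theory Num.Theory.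
Import numFieldNormedType.Exports.
Local Open Scope ring_scope.

Set Implicit Arguments.
Unset Strict Implicit.
Unset Printing Implicit Defensive.

(* In the coordinates (X, t) the Gram matrix of the left-invariant metric factors
   as U *m U^T with U block unitriangular, so its determinant is 1, its inverse
   is explicit, and the Laplace-Beltrami operator is the divergence of
   g^ij d_j f. Each coefficient of g^ij d_j f is constant along the direction in
   which it gets differentiated, hence no first-order term survives; the two
   mixed terms J(X)_k/2 d_k d_t and J(X)_k/2 d_t d_k add up to d_t D because
   second derivatives commute, which is proved from Frechet differentiability of
   the first derivatives. On phi(X) e^(i k t) with k = 2 lambda, d_t is
   multiplication by i k. *)

(** * Directional derivatives along lines *)

Section RealCalculus.
Variable R : realType.

(** A directional derivative sees only the increments along one line, so it can be transported
    between the group, its slices and the real line. *)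
Lemma eq_growth_derive (V V' : normedModType R) (f : V -> R) (g : V' -> R)
    (v p : V) (w q : V') :
  (forall h : R, f (h *: v + p) - f p = g (h *: w + q) - g q) ->
  'D_v f p = 'D_w g q.
Proof.
move=> fg; rewrite /derive; under eq_fun do rewrite /= fg.
by [].
Qed.

Lemma eq_growth_derivable (V V' : normedModType R) (f : V -> R) (g : V' -> R)
    (v p : V) (w q : V') :
  (forall h : R, f (h *: v + p) - f p = g (h *: w + q) - g q) ->
  derivable g q w -> derivable f p v.
Proof.
move=> fg dg; rewrite /derivable; under eq_fun do rewrite /= fg.
exact: dg.
Qed.

(** Restriction to a line, in the form that the mean value theorem consumes. *)
Lemma is_derive_line (V : normedModType R) (f : V -> R) (u q : V) (s : R) :
  differentiable f (s *: u + q) ->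
  is_derive s 1 (fun r : R => f (r *: u + q)) ('D_u f (s *: u + q)).
Proof.
move=> df; have E (h : R) : f ((h *: 1 + s) *: u + q) - f (s *: u + q) =
    f (h *: u + (s *: u + q)) - f (s *: u + q).
  by rewrite [h *: 1]mulr1 scalerDl addrA.
split; last by apply: eq_growth_derive => h; exact: E.
apply: (eq_growth_derivable (g := f) (w := u) (q := s *: u + q)) => [h|].
  exact: E.
exact: diff_derivable.
Qed.

(** * Symmetry of second directional derivatives *)

Lemma differentiable_nbhs_le (V : normedModType R) (g : V -> R)
    (p : V) (e : R) : differentiable g p -> 0 < e ->
  exists2 d : R, 0 < d & forall w : V, `|w| < d ->
    `|g (w + p) - (g p + 'd g p w)| <= e * `|w|.
Proof.
move=> dg e0; have /eqaddoP /(_ e e0) := diff_locally dg.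
move=> /nbhs_norm0P[d /= d0 H]; by exists d.
Qed.

(* The mean value theorem in the direction [u], followed by the Frechet
   expansion of ['D_u f] at [p]. *)
Lemma second_difference_le (V : normedModType R) (f : V -> R)
    (p u v : V) (e : R) :
  (forall q, differentiable f q) -> differentiable ('D_u f) p -> 0 < e ->
  exists2 d : R, 0 < d & forall h : R, 0 < h -> h < d ->
    `|f (h *: u + (h *: v + p)) - f (h *: u + p) - f (h *: v + p) + f p
      - h ^+ 2 * 'D_v ('D_u f) p| <= e * h ^+ 2.
Proof.
(* For [0 < c < h], both [c *: u + h *: v] and [c *: u] have norm at most [h * m]; the summand 1
   keeps [m] positive when [u] and [v] vanish. *)
move=> df dg e0; set g := 'D_u f; set m := `|u| + `|v| + 1.
have m0 : 0 < m by rewrite ltr_wpDl// addr_ge0.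
(* Two Frechet remainders, each at most [e / (2 * m) * (h * m)], add up to [e * h]; the mean value
   theorem supplies the other factor [h]. *)
have e10 : 0 < e / (2 * m) by rewrite divr_gt0// mulr_gt0.
have [d d0 H] := differentiable_nbhs_le dg e10.
exists (d / m) => [|h h0 hd]; first by rewrite divr_gt0.
have hm : h * m < d by rewrite -ltr_pdivlMr.
(* [F h - F 0] is the second difference, and [F] has a derivative expressed by [g]. *)
pose F (s : R) : R := f (s *: u + (h *: v + p)) - f (s *: u + p).
have dF (s : R) : is_derive s 1 F (g (s *: u + (h *: v + p)) - g (s *: u + p)).
  by apply: is_deriveB; apply: is_derive_line.
have cF : {within `[0, h], continuous F}%classic.
  apply: derivable_within_continuous => s _.
  by have [] := dF s.
have [c] := MVT h0 (fun s _ => dF s) cF.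
rewrite in_itv/= subr0 => /andP[c0 ch] EF.
have w1 : `|c *: u + h *: v| <= h * m.
  rewrite (le_trans (ler_normD _ _))// !normrZ !gtr0_norm//.
  rewrite /m !mulrDr mulr1 ler_wpDr ?(ltW h0)// lerD2r ler_wpM2r//.
  exact: (ltW ch).
have w2 : `|c *: u| <= h * m.
  rewrite normrZ gtr0_norm// /m !mulrDr mulr1 -addrA ler_wpDr//.
    by rewrite addr_ge0 ?mulr_ge0 ?(ltW h0).
  by rewrite ler_wpM2r// (ltW ch).
have := H _ (le_lt_trans w1 hm); have := H _ (le_lt_trans w2 hm).
rewrite -addrA => H2 H1.
(* The [u] parts of the two displacements cancel in the differential, which leaves the derivative
   along [h *: v]. *)
have ED : h * 'D_v g p = 'd g p (c *: u + h *: v) - 'd g p (c *: u).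
  rewrite deriveE// -linearB addrC addKr.
  by rewrite linearZ.
have -> : f (h *: u + (h *: v + p)) - f (h *: u + p) - f (h *: v + p) + f p
      - h ^+ 2 * 'D_v g p =
    h * ((g (c *: u + (h *: v + p)) - (g p + 'd g p (c *: u + h *: v)))
         - (g (c *: u + p) - (g p + 'd g p (c *: u)))).
  move: EF; rewrite /F !scale0r !add0r => EF.
  have -> : f (h *: u + (h *: v + p)) - f (h *: u + p) - f (h *: v + p) + f p =
    (g (c *: u + (h *: v + p)) - g (c *: u + p)) * h by rewrite -EF; ring.
  rewrite expr2 -mulrA ED; ring.
rewrite normrM gtr0_norm// mulrC expr2 mulrA ler_pM2r//.
rewrite (le_trans (ler_normB _ _))// (le_trans (lerD H1 H2))//.
rewrite -mulrDr (le_trans (ler_wpM2l (ltW e10) (lerD w1 w2)))//.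
by rewrite le_eqVlt; apply/orP; left; apply/eqP; field; rewrite gt_eqF.
Qed.

(** The second difference is symmetric in [u] and [v]; divided by [h ^+ 2], it lies within [e / 2]
    of both iterated derivatives. *)
Lemma deriveC (V : normedModType R) (f : V -> R) (p u v : V) :
  (forall q, differentiable f q) ->
  differentiable ('D_u f) p -> differentiable ('D_v f) p ->
  'D_v ('D_u f) p = 'D_u ('D_v f) p.
Proof.
move=> df du dv; apply/eqP; rewrite -subr_eq0 -normr_le0.
apply/ler_addgt0Pl => e e0; rewrite addr0.
have e20 : 0 < e / 2 by rewrite divr_gt0.
have [d1 d10 H1] := second_difference_le v df du e20.
have [d2 d20 H2] := second_difference_le u df dv e20.
pose h := Num.min d1 d2 / 2.
have m0 : 0 < Num.min d1 d2 by rewrite lt_min d10.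
have h0 : 0 < h by rewrite divr_gt0.
have hm : h < Num.min d1 d2 by rewrite ltr_pdivrMr// ltr_pMr// ltr1n.
move: (hm); rewrite lt_min => /andP[hd1 hd2].
have := H1 h h0 hd1; have := H2 h h0 hd2.
(* Both estimates now speak of the same corner of the parallelogram, so its value [A] cancels. *)
rewrite (addrCA (h *: v)); move: (f (h *: u + _)) => A.
move: (f (h *: u + p)) (f (h *: v + p)) (f p) => B C D.
move: ('D_u ('D_v f) p : R) ('D_v ('D_u f) p : R) => x y B2 B1.
have h20 : 0 < h ^+ 2 by rewrite exprn_gt0.
rewrite -(ler_pM2r h20) -{1}(gtr0_norm h20) -normrM.
have -> : (y - x) * h ^+ 2 =
  (A - C - B + D - h ^+ 2 * x) - (A - B - C + D - h ^+ 2 * y) by ring.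
rewrite (le_trans (ler_normB _ _))// (le_trans (lerD B2 B1))//.
by rewrite -mulrDl -splitr.
Qed.

(** * Products with a coefficient that is constant along a direction *)

Lemma derivableM_const_along (V : normedModType R) (c f : V -> R) (v p : V) :
  (forall h : R, c (h *: v + p) = c p) -> differentiable f p ->
  derivable (fun q => c q * f q) p v.
Proof.
move=> cE df; apply: (eq_growth_derivable (g := c p *: f) (w := v) (q := p)) => [h|].
  by rewrite cE.
by apply: derivableZ; exact: diff_derivable.
Qed.

(** On the line through [p] the product has the same increments as [c p *: f], so no term with a
    derivative of [c] arises. *)
Lemma deriveM_const_along (V : normedModType R) (c f : V -> R) (v p : V) :
  (forall h : R, c (h *: v + p) = c p) -> differentiable f p ->
  'D_v (fun q => c q * f q) p = c p * 'D_v f p.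
Proof.
move=> cE df; rewrite -[RHS]deriveMl; last exact: diff_derivable.
by apply: eq_growth_derive => h; rewrite cE.
Qed.

(** * Functions with Frechet differentiable first derivatives *)

Definition twice_differentiable (V : normedModType R) (f : V -> R) :=
  (forall p, differentiable f p) /\ (forall v p, differentiable ('D_v f) p).

Lemma differentiable_fst (V W : normedModType R) (p : V * W) :
  differentiable (fst : V * W -> V) p.
Proof. by apply: (@linear_differentiable _ _ _ fst) => q; exact: cvg_fst. Qed.

Lemma differentiable_snd (V W : normedModType R) (p : V * W) :
  differentiable (snd : V * W -> W) p.
Proof. by apply: (@linear_differentiable _ _ _ snd) => q; exact: cvg_snd. Qed.

(** Lists of length zero and one in [smooth] give exactly the regularity that [deriveC] asks for;
    stopping at this order keeps the closure rules below short. *)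
Lemma smooth_twice_differentiable (V : normedModType R) (f : V -> R) :
  smooth f -> twice_differentiable f.
Proof. by move=> sf; split=> [|v]; [exact: (sf [::])|exact: (sf [:: v])]. Qed.

Lemma twice_differentiableM (V : normedModType R) (f g : V -> R) :
  twice_differentiable f -> twice_differentiable g ->
  twice_differentiable (f * g).
Proof.
move=> [df ddf] [dg ddg]; split=> [p|v p]; first exact: differentiableM.
have -> : 'D_v (f * g) = f * 'D_v g + g * 'D_v f.
  by apply/funext => q; rewrite deriveM//; exact: diff_derivable.
by apply: differentiableD; apply: differentiableM.
Qed.

Lemma twice_differentiableD (V : normedModType R) (f g : V -> R) :
  twice_differentiable f -> twice_differentiable g ->
  twice_differentiable (f + g).
Proof.
move=> [df ddf] [dg ddg]; split=> [p|v p]; first exact: differentiableD.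
have -> : 'D_v (f + g) = 'D_v f + 'D_v g.
  by apply/funext => q; rewrite deriveD//; exact: diff_derivable.
exact: differentiableD.
Qed.

Lemma twice_differentiableN (V : normedModType R) (f : V -> R) :
  twice_differentiable f -> twice_differentiable (- f).
Proof.
move=> [df ddf]; split=> [p|v p]; first exact: differentiableN.
have -> : 'D_v (- f) = - 'D_v f.
  by apply/funext => q; rewrite deriveN//; exact: diff_derivable.
exact: differentiableN.
Qed.

Lemma twice_differentiable_fst (V W : normedModType R) (f : V -> R) :
  twice_differentiable f ->
  twice_differentiable (fun p : V * W => f p.1).
Proof.
move=> [df ddf]; split=> [p|v p].
  by apply: differentiable_comp; [exact: differentiable_fst|exact: df].
(* The two difference quotients are convertible: the first component of [h *: v + q] computes to
   [h *: v.1 + q.1]. *)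
have -> : 'D_v (fun p : V * W => f p.1) = 'D_(v.1) f \o fst by [].
by apply: differentiable_comp; [exact: differentiable_fst|exact: ddf].
Qed.

Lemma twice_differentiable_snd (V W : normedModType R) (f : W -> R) :
  twice_differentiable f ->
  twice_differentiable (fun p : V * W => f p.2).
Proof.
move=> [df ddf]; split=> [p|v p].
  by apply: differentiable_comp; [exact: differentiable_snd|exact: df].
have -> : 'D_v (fun p : V * W => f p.2) = 'D_(v.2) f \o snd by [].
by apply: differentiable_comp; [exact: differentiable_snd|exact: ddf].
Qed.

(** * Derivatives of cosines and sines *)

Lemma derive_real (f : R -> R) (v t : R) :
  differentiable f t -> 'D_v f t = v * 'D_1 f t.
Proof.
move=> df; rewrite !deriveE//; transitivity ('d f t (v *: 1)).
  by rewrite [v *: 1]mulr1.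
by rewrite linearZ.
Qed.

Lemma is_derive_cosM (k t : R) :
  is_derive t 1 (fun s => cos (k * s)) (- k * sin (k * t)).
Proof.
have Hk : is_derive t 1 (fun s : R => k * s) k.
  by apply: (is_derive_eq (is_deriveZ k (is_derive_id t 1))); rewrite [LHS]mulr1.
apply: (is_derive_eq (is_derive1_comp (is_derive_cos (k * t)) Hk)).
by rewrite mulrC mulrN mulNr.
Qed.

Lemma is_derive_sinM (k t : R) :
  is_derive t 1 (fun s => sin (k * s)) (k * cos (k * t)).
Proof.
have Hk : is_derive t 1 (fun s : R => k * s) k.
  by apply: (is_derive_eq (is_deriveZ k (is_derive_id t 1))); rewrite [LHS]mulr1.
apply: (is_derive_eq (is_derive1_comp (is_derive_sin (k * t)) Hk)).
by rewrite mulrC.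
Qed.

Lemma twice_differentiable_cosM (k : R) :
  twice_differentiable (fun s : R => cos (k * s)).
Proof.
have dc t : differentiable (fun s : R => cos (k * s)) t.
  by apply/derivable1_diffP; have [] := is_derive_cosM k t.
split=> // v p.
have -> : 'D_v (fun s : R => cos (k * s)) = (- (v * k)) *: (fun s => sin (k * s)).
  apply/funext => t; rewrite derive_real//.
  by rewrite (@derive_val _ _ _ _ _ _ _ (is_derive_cosM k t)) mulrA mulrN.
apply: differentiableZ; apply/derivable1_diffP.
by have [] := is_derive_sinM k p.
Qed.

Lemma twice_differentiable_sinM (k : R) :
  twice_differentiable (fun s : R => sin (k * s)).
Proof.
have ds t : differentiable (fun s : R => sin (k * s)) t.
  by apply/derivable1_diffP; have [] := is_derive_sinM k t.
split=> // v p.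
have -> : 'D_v (fun s : R => sin (k * s)) = (v * k) *: (fun s => cos (k * s)).
  apply/funext => t; rewrite derive_real//.
  by rewrite (@derive_val _ _ _ _ _ _ _ (is_derive_sinM k t)) mulrA.
apply: differentiableZ; apply/derivable1_diffP.
by have [] := is_derive_cosM k p.
Qed.

(** * Linear combinations and the Laplacian of a metric of determinant 1 *)

(** The constants stand on the right to match the real and imaginary parts of a product with a fixed
    complex number. *)
Lemma derive_lincomb (V : normedModType R) (f g : V -> R) (v p : V) (a b : R) :
  differentiable f p -> differentiable g p ->
  'D_v (fun q => f q * a + g q * b) p = 'D_v f p * a + 'D_v g p * b.
Proof.
move=> df dg; have -> : (fun q => f q * a + g q * b) = a *: f + b *: g.
  by apply/funext => q; rewrite mulrC (mulrC (g q)).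
rewrite deriveD; try by apply: derivableZ; exact: diff_derivable.
by rewrite !deriveZ ?[_ *: _]mulrC//; exact: diff_derivable.
Qed.

Lemma laplace_beltrami_unimodular (V : normedModType R) n (e : 'I_n -> V)
    (g : V -> V -> V -> R) (f : V -> R) (p : V) :
  (forall q, \det (gram e g q) = 1) ->
  laplace_beltrami e g f p =
  \sum_(i < n) 'D_(e i) (fun q =>
     \sum_(j < n) invmx (gram e g q) i j * 'D_(e j) f q) p.
Proof.
move=> dE; rewrite /laplace_beltrami dE sqrtr1 invr1 mul1r.
apply: eq_bigr => i _; congr ('D_(e i) _ p).
by apply/funext => q; rewrite dE sqrtr1 mul1r.
Qed.

End RealCalculus.

(** * The left-invariant metric in coordinates *)

Section Heisenberg.
Variable R : realType.

Local Notation plane := ('rV[R]_2).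
Local Notation heis := ('rV[R]_2 * R)%type.
Local Notation Xdir k := ((delta_mx 0 k, 0) : heis).
Local Notation T := ((0, 1) : heis).

Lemma heis_basis_lshift (k : 'I_2) : heis_basis R (lshift 1 k) = Xdir k.
Proof. by rewrite /heis_basis (unsplitK (inl k)). Qed.

Lemma heis_basis_rshift (k : 'I_1) : heis_basis R (rshift 2 k) = T.
Proof. by rewrite /heis_basis (unsplitK (inr k)). Qed.

Lemma bracket_delta (X : plane) (k : 'I_2) :
  bracket X (delta_mx 0 k) = J X 0 k.
Proof.
rewrite /bracket /dot (bigD1 k)//= big1 ?addr0.
  by rewrite [delta_mx _ _ _ _]mxE !eqxx mulr1.
by move=> i ik; rewrite [delta_mx _ _ _ _]mxE eqxx (negPf ik) mulr0.
Qed.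

Lemma dot_JJ (X : plane) : dot (J X) (J X) = dot X X.
Proof.
rewrite /dot !big_ord_recl !big_ord0 [J X 0 _]mxE [J X 0 _]mxE /= mulrNN addr0.
(* The indices left by [big_ord_recl] agree with the literals [0] and [1] only through their
   values. *)
rewrite ?addr0 addrC; congr (_ + _); congr (X _ _ * X _ _); exact/val_inj.
Qed.

Lemma enorm_sqr (X : plane) : enorm X ^+ 2 = dot X X.
Proof.
by rewrite sqr_sqrtr// /dot sumr_ge0// => i _; rewrite -expr2 sqr_ge0.
Qed.

(** The [k]-th component of [J X] involves only the other coordinate of [X]. *)
Lemma J_delta (X : plane) (k : 'I_2) (h : R) :
  J (h *: delta_mx 0 k + X) 0 k = J X 0 k.
Proof.
by case: k => [[|[|//]] lk2]; rewrite !mxE /= ?mulr0 ?add0r.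
Qed.

(* Left translation to the identity sends the k-th coordinate vector of the plane
   at (X, t) to itself plus [shear X 0 k] in the central direction. *)
Definition shear (X : plane) : plane := (- 2^-1) *: J X.

(** The rows of the first factor are the coordinate vectors pulled back to the identity, where the
    inner product is Euclidean; the second factor is its transpose. *)
Lemma gram_heis (p : heis) :
  gram (heis_basis R) (@heis_metric R) p =
  block_mx 1%:M (shear p.1)^T 0 1%:M *m block_mx 1%:M 0 (shear p.1) 1%:M.
Proof.
set a := shear p.1; rewrite mulmx_block ?mulmx1 ?mul1mx ?mul0mx ?mulmx0 ?add0r.
have E (w : heis) : 'd (heis_mul (heis_inv p)) p w = (w.1, w.2 - bracket p.1 w.1 / 2).
  by rewrite diff_heis_mul bracketNl mulNr.
have dd (k l : 'I_2) : dot (delta_mx 0 k) (delta_mx 0 l) = (k == l)%:R :> R.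
  rewrite /dot (bigD1 k)//= big1 ?addr0.
    by rewrite !mxE !eqxx mul1r.
  by move=> i ik; rewrite !mxE eqxx (negPf ik) mul0r.
have d0 (Y : plane) : dot Y 0 = 0.
  by rewrite /dot big1// => i _; rewrite [X in _ * X]mxE mulr0.
have d0l (Y : plane) : dot 0 Y = 0.
  by rewrite /dot big1// => i _; rewrite [X in X * _]mxE mul0r.
have Ea (k : 'I_2) : (0 : R) - bracket p.1 (delta_mx 0 k) / 2 = a 0 k.
  by rewrite bracket_delta [RHS]mxE sub0r mulNr mulrC.
clearbody a; have b0 : (1 : R) - bracket p.1 0 / 2 = 1 by rewrite /bracket d0 mul0r subr0.
apply/matrixP => i j; rewrite mxE /heis_metric.
have [k ->|k ->] := split_ordP i; have [l ->|l ->] := split_ordP j.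
- rewrite block_mxEul !heis_basis_lshift !E /heis_inner /= !Ea dd.
  by rewrite !mxE big_ord1 mxE ord1.
- rewrite block_mxEur heis_basis_lshift heis_basis_rshift !E /heis_inner /=.
  by rewrite !Ea b0 d0 add0r mulr1 mxE ord1.
- rewrite block_mxEdl heis_basis_lshift heis_basis_rshift !E /heis_inner /=.
  by rewrite !Ea b0 d0l add0r mul1r ord1.
- rewrite block_mxEdr !heis_basis_rshift !E /heis_inner /=.
  by rewrite b0 d0 add0r mulr1 !ord1 mxE eqxx.
Qed.

Lemma det_gram_heis (p : heis) : \det (gram (heis_basis R) (@heis_metric R) p) = 1.
Proof. by rewrite gram_heis det_mulmx det_ublock det_lblock !det1 !mulr1. Qed.

Lemma invmx_gram_heis (p : heis) (a := shear p.1) :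
  invmx (gram (heis_basis R) (@heis_metric R) p) =
  block_mx 1%:M (- a^T) (- a) (a *m a^T + 1%:M).
Proof.
set B := RHS; have GU : gram (heis_basis R) (@heis_metric R) p \in unitmx.
  by rewrite unitmxE det_gram_heis unitr1.
suff GB : gram (heis_basis R) (@heis_metric R) p *m B = 1%:M.
  by rewrite -[B]mul1mx -(mulVmx GU) -mulmxA GB mulmx1.
(* Each unitriangular factor is inverted by negating its off-diagonal block, and the order of the
   factors is reversed. *)
have -> : B = block_mx 1%:M 0 (- a) 1%:M *m block_mx 1%:M (- a^T) 0 1%:M.
  rewrite mulmx_block ?mulmx1 ?mul1mx ?mul0mx ?mulmx0 ?addr0.
  by rewrite mulNmx mulmxN opprK.
rewrite gram_heis -/a mulmxA -(mulmxA (block_mx 1%:M a^T 0 1%:M)).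
rewrite [block_mx _ 0 _ _ *m block_mx _ 0 _ _]mulmx_block.
rewrite ?mulmx1 ?mul1mx ?mul0mx ?mulmx0 ?add0r ?addr0 subrr -scalar_mx_block.
rewrite mulmx1 mulmx_block ?mulmx1 ?mul1mx ?mul0mx ?mulmx0 ?add0r ?addr0.
by rewrite addrC subrr -scalar_mx_block.
Qed.

(** * Gradient and Laplacian on the group *)

Lemma derive_slice (f : heis -> R) (X v : plane) (t : R) :
  'D_v (fun Y => f (Y, t)) X = 'D_((v, 0) : heis) f (X, t).
Proof.
apply: eq_growth_derive => h; congr (f (_, _) - _).
by rewrite /= scaler0 add0r.
Qed.

Lemma derive_horizontal (f : heis -> R) (p : heis) (Y : plane) :
  differentiable f p ->
  'D_((Y, 0) : heis) f p = \sum_(k < 2) Y 0 k * 'D_(Xdir k) f p.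
Proof.
move=> df; have -> : ((Y, 0) : heis) = \sum_(k < 2) Y 0 k *: Xdir k.
  rewrite {1}[Y]row_sum_delta.
  rewrite !big_ord_recl !big_ord0 !addr0; congr (_, _).
  by rewrite /= !scaler0 addr0.
rewrite deriveE// linear_sum; apply: eq_bigr => k _.
by rewrite linearZ deriveE.
Qed.

Local Notation Ginv q := (invmx (gram (heis_basis R) (@heis_metric R) q)).

Lemma grad_horizontal (f : heis -> R) (q : heis) (k : 'I_2) :
  \sum_(j < 2 + 1) Ginv q (lshift 1 k) j * 'D_(heis_basis R j) f q =
  'D_(Xdir k) f q + J q.1 0 k / 2 * 'D_T f q.
Proof.
rewrite invmx_gram_heis big_split_ord big_ord1 /=.
rewrite block_mxEur heis_basis_rshift (bigD1 k)//= big1 => [|l lk].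
  rewrite addr0 block_mxEul heis_basis_lshift [1%:M k k]mxE eqxx mul1r.
  by congr (_ + _ * _); rewrite 2!mxE [shear _ _ _]mxE mulNr opprK mulrC.
by rewrite block_mxEul [1%:M k l]mxE eq_sym (negPf lk) mul0r.
Qed.

(** With [a] the shear, the corner entry [a *m a^T + 1%:M] is 1 plus a quarter of the squared norm
    of [J X], and [J] is an isometry. *)
Lemma grad_vertical (f : heis -> R) (q : heis) (i : 'I_1) :
  \sum_(j < 2 + 1) Ginv q (rshift 2 i) j * 'D_(heis_basis R j) f q =
  \sum_(k < 2) J q.1 0 k / 2 * 'D_(Xdir k) f q
  + (1 + enorm q.1 ^+ 2 / 4) * 'D_T f q.
Proof.
have -> : i = ord0 by exact: ord1.
rewrite invmx_gram_heis big_split_ord big_ord1 /=.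
rewrite block_mxEdr heis_basis_rshift.
apply: (congr2 +%R); last apply: (congr1 ( *%R^~ _)).
  apply: eq_bigr => k _; rewrite block_mxEdl heis_basis_lshift.
  by congr (_ * _); rewrite mxE [shear _ _ _]mxE mulNr opprK mulrC.
rewrite [LHS]mxE addrC [1%:M 0 0]mxE eqxx; congr (_ + _).
rewrite enorm_sqr -dot_JJ /dot mxE mulr_suml; apply: eq_bigr => k _.
rewrite [_^T _ _]mxE [shear _ _ _]mxE; move: (J _ _ _) => x; lra.
Qed.

Lemma laplace_beltrami_heis (f : heis -> R) (p : heis) :
  twice_differentiable f ->
  laplace_beltrami (heis_basis R) (@heis_metric R) f p =
  laplace_plane (fun X => f (X, p.2)) p.1
  + (1 + enorm p.1 ^+ 2 / 4) * 'D_T ('D_T f) p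
  + 'D_T (fun q => dbullet_real (fun X => f (X, q.2)) q.1) p.
Proof.
move=> [df ddf]; rewrite laplace_beltrami_unimodular; last exact: det_gram_heis.
(* Moving along the center fixes [X], so all coefficients are constant in the direction [T]. *)
have sT (h : R) : (h *: T + p).1 = p.1 by rewrite /= scaler0 add0r.
have Eh (k : 'I_2) : 'D_(heis_basis R (lshift 1 k)) (fun q =>
      \sum_(j < 2 + 1) Ginv q (lshift 1 k) j * 'D_(heis_basis R j) f q) p =
    'D_(Xdir k) ('D_(Xdir k) f) p
    + J p.1 0 k / 2 * 'D_T ('D_(Xdir k) f) p.
  under eq_fun do rewrite grad_horizontal.
  have JE (h : R) : J (h *: Xdir k + p).1 0 k / 2 = J p.1 0 k / 2.
    by rewrite J_delta.
  rewrite heis_basis_lshift deriveD; first last.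
  - exact: derivableM_const_along.
  - exact: diff_derivable.
  rewrite (deriveM_const_along JE (ddf T p)).
  apply: (congr2 +%R (erefl _)); apply: (congr1 ( *%R _)).
  (* The horizontal components produce the mixed derivative with ['D_T] innermost; it is put in the
     order in which the vertical component produces it. *)
  exact: deriveC.
have Ev : 'D_(heis_basis R (rshift 2 ord0)) (fun q =>
      \sum_(j < 2 + 1) Ginv q (rshift 2 ord0) j * 'D_(heis_basis R j) f q) p =
    \sum_(k < 2) J p.1 0 k / 2 * 'D_T ('D_(Xdir k) f) p
    + (1 + enorm p.1 ^+ 2 / 4) * 'D_T ('D_T f) p.
  under eq_fun do rewrite grad_vertical.
  have dk (k : 'I_2) :
      derivable (fun q : heis => J q.1 0 k / 2 * 'D_(Xdir k) f q) p T.
    by apply: derivableM_const_along => // h; rewrite sT.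
  have sumE : (fun q : heis => \sum_(k < 2) J q.1 0 k / 2 * 'D_(Xdir k) f q) =
      \sum_(k < 2) (fun q : heis => J q.1 0 k / 2 * 'D_(Xdir k) f q).
    by apply/funext => q; rewrite fct_sumE.
  rewrite heis_basis_rshift deriveD; first last.
  - by apply: derivableM_const_along => // h; rewrite sT.
  - by rewrite sumE; exact: derivable_sum.
  rewrite sumE derive_sum//; apply: (congr2 +%R).
    apply: eq_bigr => k _; apply: deriveM_const_along => // h.
    by rewrite sT.
  by apply: deriveM_const_along => // h; rewrite sT.
have Ed : 'D_T (fun q => dbullet_real (fun X => f (X, q.2)) q.1) p =
    \sum_(k < 2) J p.1 0 k * 'D_T ('D_(Xdir k) f) p.
  have -> : (fun q : heis => dbullet_real (fun X => f (X, q.2)) q.1) =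
      \sum_(k < 2) (fun q : heis => J q.1 0 k * 'D_(Xdir k) f q).
    apply/funext => q; rewrite fct_sumE /dbullet_real derive_slice.
    by rewrite derive_horizontal// -surjective_pairing.
  rewrite derive_sum => [|k].
    apply: eq_bigr => k _; apply: deriveM_const_along => // h.
    by rewrite sT.
  by apply: derivableM_const_along => // h; rewrite sT.
rewrite big_split_ord big_ord1.
apply: (etrans (congr2 +%R (eq_bigr _ (fun k _ => Eh k)) Ev)).
rewrite Ed big_split /=.
have -> : laplace_plane (fun X => f (X, p.2)) p.1 =
    \sum_(k < 2) 'D_(Xdir k) ('D_(Xdir k) f) p.
  apply: eq_bigr => k _.
  have -> : 'D_(delta_mx 0 k) (fun X => f (X, p.2)) =
      fun X => 'D_(Xdir k) f (X, p.2).
    by apply/funext => X; exact: derive_slice.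
  rewrite (derive_slice ('D_(Xdir k) f) p.1 (delta_mx 0 k) p.2).
  by rewrite -surjective_pairing.
(* The horizontal and vertical components each contribute half of the mixed term [Ed]. *)
have half (F : 'I_2 -> R) :
    \sum_(k < 2) J p.1 0 k * F k = 2 * \sum_(k < 2) J p.1 0 k / 2 * F k.
  by rewrite mulr_sumr; apply: eq_bigr => k _; field.
rewrite half; move: (\sum_(k < 2) _ * _) => S.
move: ('D_T _ _ : R) (\sum_(k < 2) _) => x y; ring.
Qed.

End Heisenberg.

(** * Complex-valued functions and characters of the center *)

Section ComplexFunctions.
Variable R : realType.

Lemma Complex_M (a b c d : R) :
  Complex a b * Complex c d = Complex (a * c - b * d) (a * d + b * c).
Proof. by []. Qed.

Lemma real_complexM (a b c : R) : a%:C%C * Complex b c = Complex (a * b) (a * c).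
Proof. by rewrite Complex_M !mul0r subr0 addr0. Qed.

Lemma LaplaceE (f : heis R -> R[i]) (p : heis R) :
  twice_differentiable (fun q => complex.Re (f q)) ->
  twice_differentiable (fun q => complex.Im (f q)) ->
  Laplace f p =
    inX (@LaplaceX R) f p
    + (1 + enorm p.1 ^+ 2 / 4)%:C%C * dt (dt f) p
    + dt (inX (@Dbullet R) f) p.
Proof.
move=> fr fi; rewrite /Laplace /complexify !laplace_beltrami_heis//.
by rewrite /dt /complexify real_complexM.
Qed.

(** The exponential of [i k t], split so that the real trigonometric lemmas apply. *)
Definition wave (k t : R) : R[i] := Complex (cos (k * t)) (sin (k * t)).

(** The exponent is purely imaginary, so the [expR] factor is 1; the frequency is displayed as twice
    the [lambda] of [box]. *)
Lemma characterE (L : R) (gamma : int) (t : R) :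
  character L gamma t = wave (2 * (pi * gamma%:~R / L)) t.
Proof.
rewrite /character /cexp Complex_M /=.
rewrite !(mul0r, mulr0, mul1r, mulr1, subr0, add0r, oppr0).
by rewrite expR0 !mul1r addr0 /wave; congr (Complex (cos _) (sin _)); ring.
Qed.

Lemma cos_sin_add_2pi_int (x : R) (m : int) :
  cos (x + 2 * pi * m%:~R) = cos x /\ sin (x + 2 * pi * m%:~R) = sin x.
Proof.
have N (n : nat) (y : R) :
    cos (y + 2 * pi * n%:R) = cos y /\ sin (y + 2 * pi * n%:R) = sin y.
  have -> : 2 * pi * n%:R = (pi *+ 2) *+ n :> R by rewrite mulr_natr mulr_natl.
  by rewrite (periodicn (@cosD2pi R)) (periodicn (@sinD2pi R)).
case: m => n; first exact: N.
(* For a negative multiple, the natural case is applied at the shifted point and shifts it back to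
   [x]. *)
have [<- <-] := N n.+1 (x + 2 * pi * (Negz n)%:~R).
by rewrite NegzE mulrNz mulrN addrNK.
Qed.

Lemma wave_period (k t : R) (m : int) (s : R) :
  k * s = 2 * pi * m%:~R -> wave k (s + t) = wave k t.
Proof.
move=> ks; rewrite /wave mulrDr ks addrC.
by have [-> ->] := cos_sin_add_2pi_int (k * t) m.
Qed.

Lemma derive_trig (a b k t : R) :
  'D_1 (fun s : R => a * cos (k * s) + b * sin (k * s)) t =
  k * (b * cos (k * t) - a * sin (k * t)).
Proof.
have H := is_deriveD (is_deriveZ a (is_derive_cosM k t))
  (is_deriveZ b (is_derive_sinM k t)).
rewrite [LHS](@derive_val _ _ _ _ _ _ _ H) /GRing.scale /=; ring.
Qed.

Lemma Re_wave (z : R[i]) (k t : R) : complex.Re (z * wave k t) =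
  complex.Re z * cos (k * t) + (- complex.Im z) * sin (k * t).
Proof. by case: z => u w; rewrite Complex_M /= mulNr. Qed.

Lemma Im_wave (z : R[i]) (k t : R) : complex.Im (z * wave k t) =
  complex.Im z * cos (k * t) + complex.Re z * sin (k * t).
Proof. by case: z => u w; rewrite Complex_M /= addrC. Qed.

(** [G] is constant along the center. It is kept arbitrary because the rule is applied to [phi], to
    a multiple of [phi] for the second derivative, and to [Dbullet phi]. *)
Lemma dt_wave (k : R) (G : plane R -> R[i]) (p : heis R) :
  dt (fun q => G q.1 * wave k q.2) p = 'i%C * k%:C%C * (G p.1 * wave k p.2).
Proof.
case: p => X t; rewrite /dt /complexify /=.
have slice (F : R[i] -> R) :
    'D_((0, 1) : heis R) (fun q => F (G q.1 * wave k q.2)) (X, t) =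
    'D_1 (fun s : R => F (G X * wave k s)) t.
  by apply: eq_growth_derive => h /=; rewrite scaler0 add0r.
rewrite !slice.
rewrite (funext (Re_wave (G X) k)) (funext (Im_wave (G X) k)) !derive_trig.
rewrite /wave; case: (G X) => u w.
by rewrite !Complex_M /=; congr Complex; ring.
Qed.

Lemma twice_differentiable_phi (k : R) (phi : plane R -> R[i]) :
  csmooth phi ->
  twice_differentiable (fun q : heis R => complex.Re (phi q.1 * wave k q.2)) /\
  twice_differentiable (fun q : heis R => complex.Im (phi q.1 * wave k q.2)).
Proof.
move=> [/smooth_twice_differentiable sr /smooth_twice_differentiable si].
have c2 := twice_differentiable_snd (plane R) (twice_differentiable_cosM k).
have s2 := twice_differentiable_snd (plane R) (twice_differentiable_sinM k).
have r1 := twice_differentiable_fst R sr.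
have i1 := twice_differentiable_fst R si.
split; [under eq_fun do rewrite Re_wave|under eq_fun do rewrite Im_wave].
  apply: twice_differentiableD; apply: twice_differentiableM => //.
  exact: twice_differentiableN.
by apply: twice_differentiableD; apply: twice_differentiableM.
Qed.

(** * Passage to the operator [box] and descent to the quotient *)

Lemma laplace_plane_lincomb (f g : plane R -> R) (X : plane R) (a b : R) :
  twice_differentiable f -> twice_differentiable g ->
  laplace_plane (fun Y => f Y * a + g Y * b) X =
  laplace_plane f X * a + laplace_plane g X * b.
Proof.
move=> [df ddf] [dg ddg].
have E (i : 'I_2) (e := delta_mx 0 i : plane R) :
    'D_e ('D_e (fun Y => f Y * a + g Y * b)) X =
    'D_e ('D_e f) X * a + 'D_e ('D_e g) X * b.
  rewrite (funext (fun Y => derive_lincomb e a b (df Y) (dg Y))).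
  exact: derive_lincomb.
apply: (etrans (eq_bigr _ (fun i _ => E i))).
by rewrite big_split /= -!mulr_suml.
Qed.

(** Multiplication by [z] replaces the real and imaginary parts by real combinations of the two, so
    linearity of [A] on these combinations suffices. *)
Lemma complexify_mulr (V : normedModType R) (A : (V -> R) -> V -> R)
    (f : V -> R[i]) (z : R[i]) (p : V) :
  (forall a b, A (fun q => complex.Re (f q) * a + complex.Im (f q) * b) p =
    A (fun q => complex.Re (f q)) p * a + A (fun q => complex.Im (f q)) p * b) ->
  complexify A (fun q => f q * z) p = complexify A f p * z.
Proof.
case: z => a b lin; rewrite /complexify Complex_M.
have -> : (fun q => complex.Re (f q * Complex a b)) =
    (fun q => complex.Re (f q) * a + complex.Im (f q) * (- b)).
  by apply/funext => q; case: (f q) => u w; rewrite Complex_M /= mulrN.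
have -> : (fun q => complex.Im (f q * Complex a b)) =
    (fun q => complex.Re (f q) * b + complex.Im (f q) * a).
  by apply/funext => q; case: (f q) => u w; rewrite Complex_M.
by rewrite !lin mulrN.
Qed.

(** Here [dt] multiplies by [2 i lambda]: its square gives the potential [- 4 lambda ^+ 2], and the
    mixed term becomes [2 i] times [Dbullet_lambda]. *)
Lemma Laplace_wave (lambda : R) (phi : plane R -> R[i]) (X : plane R) (t : R) :
  csmooth phi ->
  Laplace (fun p => phi p.1 * wave (2 * lambda) p.2) (X, t) =
  box lambda phi X * wave (2 * lambda) t.
Proof.
move=> sphi; have [fr fi] := twice_differentiable_phi (2 * lambda) sphi.
have [/smooth_twice_differentiable sr /smooth_twice_differentiable si] := sphi.
rewrite LaplaceE// /inX /=.
have -> : LaplaceX (fun Y => phi Y * wave (2 * lambda) t) X =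
    LaplaceX phi X * wave (2 * lambda) t.
  by apply: complexify_mulr => a b; exact: laplace_plane_lincomb.
have -> : (fun q : heis R =>
      Dbullet (fun Y => phi Y * wave (2 * lambda) q.2) q.1) =
    (fun q => Dbullet phi q.1 * wave (2 * lambda) q.2).
  apply/funext => q; apply: complexify_mulr => a b.
  by apply: derive_lincomb; [exact: sr.1|exact: si.1].
have dt_phi : dt (fun q : heis R => phi q.1 * wave (2 * lambda) q.2) =
    (fun q => 'i%C * (2 * lambda)%:C%C * phi q.1 * wave (2 * lambda) q.2).
  by apply/funext => q; rewrite dt_wave mulrA.
rewrite dt_phi (dt_wave _ (fun Y => 'i%C * (2 * lambda)%:C%C * phi Y)).
rewrite (dt_wave _ (Dbullet phi)) /=.
rewrite /box /Dbullet_lambda.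
have ii : 'i%C * 'i%C = -1 :> R[i] by rewrite -expr2 sqr_i.
have l2 : (2 * lambda)%:C%C = 2 * lambda%:C%C by rewrite rmorphM rmorph_nat.
have -> : 4 * lambda ^+ 2 * (1 + enorm X ^+ 2 / 4) =
   (1 + enorm X ^+ 2 / 4) * ((2 * lambda) * (2 * lambda)) by ring.
set c := 1 + enorm X ^+ 2 / 4.
have -> : (c * (2 * lambda * (2 * lambda)))%:C%C =
    c%:C%C * (2 * lambda%:C%C * (2 * lambda%:C%C)).
  by rewrite -l2 -!rmorphM.
rewrite l2.
(* What remains is a polynomial identity modulo [j * j = -1]. *)
move: ('i%C : R[i]) ii (LaplaceX phi X) (Dbullet phi X) (phi X) (wave _ t).
move: (lambda%:C%C) (c%:C%C) => l d j jj A B C w.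
ring: jj.
Qed.

Lemma phi_gammaE (L : R) (gamma : int) (phi : plane R -> R[i]) :
  phi_gamma L gamma phi =
  (fun p => phi p.1 * wave (2 * (pi * gamma%:~R / L)) p.2).
Proof. by apply/funext => p; rewrite /phi_gamma characterE. Qed.

(** A central element has zero bracket with [p], so it only translates [t] by [m * L], and the phase
    changes by [2 * pi] times the integer [gamma * m]. *)
Lemma phi_gamma_invariant (L : R) (gamma : int) (phi : plane R -> R[i])
    (z p : heis R) :
  L != 0 -> GammaZ L z ->
  phi_gamma L gamma phi (heis_mul z p) = phi_gamma L gamma phi p.
Proof.
move=> L0 [m ->]; rewrite phi_gammaE /= add0r bracket0l mul0r addr0.
rewrite (@wave_period _ _ (gamma * m))// intrM; field.
exact: L0.
Qed.

End ComplexFunctions.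

Theorem mainTheorem1 (R : realType) (L : R) (hL : 0 < L) :
  (forall f : heis R -> R[i], csmooth f ->
     forall p : heis R,
       Laplace f p =
         inX (@LaplaceX R) f p
         + (1 + enorm p.1 ^+ 2 / 4)%:C%C * dt (dt f) p
         + dt (inX (@Dbullet R) f) p)
  /\
  (forall (gamma : int) (phi : plane R -> R[i]), csmooth phi ->
     let lambda : R := pi * gamma%:~R / L in
     (forall z p : heis R, GammaZ L z ->
        phi_gamma L gamma phi (heis_mul z p) = phi_gamma L gamma phi p) /\
     (forall (X : plane R) (t : R),
        Laplace (phi_gamma L gamma phi) (X, t) =
        box lambda phi X * character L gamma t)).
Proof.
split=> [f [fr fi] p|gamma phi sphi lambda].
  by apply: LaplaceE; exact: smooth_twice_differentiable.
split=> [z p Gz|X t]; first by apply: phi_gamma_invariant; rewrite ?gt_eqF.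
by rewrite phi_gammaE characterE Laplace_wave.
Qed.
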